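(* For $x,y\in\mathbb{R}$ and $q\in\mathbb{C}$ with $|q|<1$, we have $$\cos_q(x\oplus_q y)=\cos_q x\,\cos_q y-\sin_q x\,\sin_q y,$$ $$\sin_q(x\oplus_q y)=\sin_q x\,\cos_q y+\cos_q x\,\sin_q y .$$
   Context: Notation: $[n]_q=\frac{1-q^n}{1-q}=1+q+\cdots+q^{n-1}$, $[n]_q!=[n]_q\cdots[1]_q$, $[0]_q!=1$, $\binom{n}{k}_q=\frac{[n]_q!}{[k]_q!\,[n-k]_q!}$. The $q$-sine and $q$-cosine are defined by $$\sin_q x=\sum_{n=0}^{\infty}\frac{(-1)^n x^{2n+1}}{[2n+1]_q!},\qquad \cos_q x=\sum_{n=0}^{\infty}\frac{(-1)^n x^{2n}}{[2n]_q!}.$$ The symbol $x\oplus_q y$ ($q$-addition) has meaning through its powers, defined by $$(x\oplus_q y)^n=\sum_{k=0}^n\binom{n}{k}_q x^k y^{n-k},$$ and a power series evaluated at $x\oplus_q y$ means that the $n$-th power of the variable is replaced by $(x\oplus_q y)^n$; thus $$\cos_q(x\oplus_q y)=\sum_{n=0}^\infty\frac{(-1)^n (x\oplus_q y)^{2n}}{[2n]_q!},\qquad \sin_q(x\oplus_q y)=\sum_{n=0}^\infty\frac{(-1)^n (x\oplus_q y)^{2n+1}}{[2n+1]_q!}.$$ *)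

(* Defs.v *)
From Stdlib Require Import Reals.
From Coquelicot Require Import Coquelicot.

Local Open Scope C_scope.

Definition qint (q : C) (n : nat) : C := (1 - q ^ n) / (1 - q).

Fixpoint qfact (q : C) (n : nat) : C :=
  match n with
  | O => 1
  | S m => qint q (S m) * qfact q m
  end.

Definition qbinom (q : C) (n k : nat) : C :=
  qfact q n / (qfact q k * qfact q (n - k)).

(* The symbol [x (+)_q y] has no value of its own, only powers.  A point at
   which a power series is evaluated is therefore given by the sequence [p] of
   its powers: [powers x] for an ordinary number [x], [qadd_powers q x y] for
   [x (+)_q y]. *)
Definition powers (x : C) : nat -> C := fun n => x ^ n.

(* [sum_n a n] has the n+1 terms [a 0, ..., a n]. *)
Definition qadd_powers (q x y : C) : nat -> C := fun n =>
  sum_n (fun k => qbinom q n k * x ^ k * y ^ (n - k)) n.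

Definition cosq_term (q : C) (p : nat -> C) (n : nat) : C :=
  (- (1)) ^ n * p (2 * n)%nat / qfact q (2 * n).

Definition sinq_term (q : C) (p : nat -> C) (n : nat) : C :=
  (- (1)) ^ n * p (2 * n + 1)%nat / qfact q (2 * n + 1).

(* The q-cosine and q-sine series have finite radius of convergence
   [1 / Cmod (1 - q)] when [Cmod q < 1], so their sums are introduced as
   relations: the series converges in C, and its sum is [s]. *)
Definition is_cosq (q : C) (p : nat -> C) (s : C) : Prop :=
  @is_series C_AbsRing C_NormedModule (cosq_term q p) s.

Definition is_sinq (q : C) (p : nat -> C) (s : C) : Prop :=
  @is_series C_AbsRing C_NormedModule (sinq_term q p) s.

Definition cauchy_prod (a b : nat -> C) : nat -> C := fun n =>
  sum_n (fun k => a k * b (n - k)%nat) n.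

(* Identities between the series themselves, convergent or not: equality of
   the homogeneous components in (x, y), of degree 2n for the cosine and 2n+1
   for the sine.  A product of two sine terms of indices j and k has degree
   2(j+k+1), whence the shift [PS_incr_1] (which prepends a zero). *)
Definition cosq_add_formal (q x y : C) : Prop :=
  forall n : nat,
    cosq_term q (qadd_powers q x y) n =
    cauchy_prod (cosq_term q (powers x)) (cosq_term q (powers y)) n
    - PS_incr_1 (V := C_NormedModule)
        (cauchy_prod (sinq_term q (powers x)) (sinq_term q (powers y))) n.

Definition sinq_add_formal (q x y : C) : Prop :=
  forall n : nat,
    sinq_term q (qadd_powers q x y) n =
    cauchy_prod (sinq_term q (powers x)) (cosq_term q (powers y)) n
    + cauchy_prod (cosq_term q (powers x)) (sinq_term q (powers y)) n.

(* Main.v *)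
(** Since [binom(n,k)_q / [n]_q! = 1 / ([k]_q! [n-k]_q!)], the degree [n] term
    of a q-series at [x (+)_q y] is the Cauchy product of the sequences
    [x ^ k / [k]_q!] and [y ^ k / [k]_q!]; splitting it by the parity of [k]
    gives the formal identities.  For the sums, [[n]_q! (1 - q) ^ n] is the
    product of the [1 - q ^ k], [1 <= k <= n], which is bounded: hence the terms
    of a convergent cosine series can only tend to 0 if [|x (1 - q)| < 1], and
    then the ratio test gives absolute convergence of both series. *)

Require Import Defs.
From Stdlib Require Import Reals.
From Coquelicot Require Import Coquelicot.
From Stdlib Require Import Lra Lia.

Local Open Scope C_scope.

(** * Complex series through their real and imaginary parts *)

Definition C_is_series : (nat -> C) -> C -> Prop :=
  @is_series C_AbsRing C_NormedModule.

Lemma Csum_O (a : nat -> C) : sum_n a 0 = a 0%nat :> C.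
Proof. exact (sum_O a). Qed.

Lemma Csum_S (a : nat -> C) (n : nat) : sum_n a (S n) = sum_n a n + a (S n) :> C.
Proof. exact (sum_Sn (G := C_AbelianMonoid) a n). Qed.

Lemma Csum_ext_loc (a b : nat -> C) (n : nat) :
  (forall k, (k <= n)%nat -> a k = b k) -> sum_n a n = sum_n b n :> C.
Proof. exact (sum_n_ext_loc (G := C_AbelianMonoid) a b n). Qed.

Lemma Csum_mult_l (c : C) (a : nat -> C) (n : nat) :
  sum_n (fun k => c * a k) n = c * sum_n a n :> C.
Proof. apply (sum_n_mult_l (K := C_Ring)). Qed.

Lemma Re_sum_n (a : nat -> C) (n : nat) :
  Re (sum_n a n) = sum_n (fun k => Re (a k)) n.
Proof.
  induction n as [|n IH].
  - now rewrite !sum_O.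
  - now rewrite !sum_Sn, <- IH.
Qed.

Lemma Im_sum_n (a : nat -> C) (n : nat) :
  Im (sum_n a n) = sum_n (fun k => Im (a k)) n.
Proof.
  induction n as [|n IH].
  - now rewrite !sum_O.
  - now rewrite !sum_Sn, <- IH.
Qed.

(** A ball of [C] is a product of two real balls, so convergence is componentwise. This is how
    theorems on real series are carried over to [C]. *)
Lemma C_is_series_Re_Im (a : nat -> C) (l : C) :
  C_is_series a l <->
  is_series (fun n => Re (a n)) (Re l) /\ is_series (fun n => Im (a n)) (Im l).
Proof.
  unfold C_is_series, is_series; split.
  - intros H; split.
    + eapply filterlim_ext; [intros n; apply Re_sum_n|].
      eapply filterlim_comp; [exact H|].
      intros P [e He]; exists e; intros z [Hz _]; apply He, Hz.
    + eapply filterlim_ext; [intros n; apply Im_sum_n|].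
      eapply filterlim_comp; [exact H|].
      intros P [e He]; exists e; intros z [_ Hz]; apply He, Hz.
  - intros [H1 H2] P [e He].
    destruct (H1 _ (locally_ball (Re l) e)) as [N1 B1].
    destruct (H2 _ (locally_ball (Im l) e)) as [N2 B2].
    exists (N1 + N2)%nat; intros n Hn; apply He; split.
    + change (ball (Re l) e (Re (sum_n a n))); rewrite Re_sum_n; apply B1; lia.
    + change (ball (Im l) e (Im (sum_n a n))); rewrite Im_sum_n; apply B2; lia.
Qed.

Lemma Re_le_Cmod (z : C) : (Rabs (Re z) <= Cmod z)%R.
Proof. apply Rle_trans with (2 := Rmax_Cmod z), Rmax_l. Qed.

Lemma Im_le_Cmod (z : C) : (Rabs (Im z) <= Cmod z)%R.
Proof. apply Rle_trans with (2 := Rmax_Cmod z), Rmax_r. Qed.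

Lemma ex_series_Rabs_le (a : nat -> R) (b : nat -> R) :
  (forall n, Rabs (a n) <= b n)%R -> ex_series b ->
  ex_series (fun n => Rabs (a n)).
Proof.
  intros Hab; apply (ex_series_le (K := R_AbsRing) (V := R_CompleteNormedModule)).
  intros n; unfold norm; simpl; unfold abs; simpl.
  rewrite Rabs_Rabsolu; apply Hab.
Qed.

(** The components of a product are a difference and a sum of two real products, so four real Cauchy
    products suffice. Each of them needs absolute convergence of the components, which are dominated
    by the moduli. *)
Lemma C_is_series_cauchy_prod (a b : nat -> C) (la lb : C) :
  C_is_series a la -> C_is_series b lb ->
  ex_series (fun n => Cmod (a n)) -> ex_series (fun n => Cmod (b n)) ->
  C_is_series (cauchy_prod a b) (la * lb).
Proof.
  rewrite !C_is_series_Re_Im; intros [ar ai] [br bi] Ha Hb.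
  assert (abs_Re : forall c : nat -> C, ex_series (fun n => Cmod (c n)) ->
            ex_series (fun n => Rabs (Re (c n)))).
  { intros c; apply ex_series_Rabs_le; intros n; apply Re_le_Cmod. }
  assert (abs_Im : forall c : nat -> C, ex_series (fun n => Cmod (c n)) ->
            ex_series (fun n => Rabs (Im (c n)))).
  { intros c; apply ex_series_Rabs_le; intros n; apply Im_le_Cmod. }
  split.
  - eapply is_series_ext; [|exact (is_series_minus _ _ _ _
      (is_series_mult _ _ _ _ ar br (abs_Re _ Ha) (abs_Re _ Hb))
      (is_series_mult _ _ _ _ ai bi (abs_Im _ Ha) (abs_Im _ Hb)))].
    intros n; unfold cauchy_prod; rewrite Re_sum_n, sum_n_Reals.
    symmetry; apply minus_sum.
  - eapply is_series_ext; [|exact (is_series_plus _ _ _ _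
      (is_series_mult _ _ _ _ ar bi (abs_Re _ Ha) (abs_Im _ Hb))
      (is_series_mult _ _ _ _ ai br (abs_Im _ Ha) (abs_Re _ Hb)))].
    intros n; unfold cauchy_prod; rewrite Im_sum_n, sum_n_Reals.
    symmetry; apply sum_plus.
Qed.

Lemma C_is_series_lim_0 (a : nat -> C) (l : C) :
  C_is_series a l -> is_lim_seq (fun n => Cmod (a n)) 0.
Proof.
  rewrite C_is_series_Re_Im; intros [Hr Hi].
  assert (Lr := ex_series_lim_0 _ (ex_intro _ _ Hr)).
  assert (Li := ex_series_lim_0 _ (ex_intro _ _ Hi)).
  apply is_lim_seq_abs in Lr; apply is_lim_seq_abs in Li.
  simpl in Lr, Li; rewrite Rabs_R0 in Lr, Li.
  apply is_lim_seq_le_le with (u := fun _ => 0%R)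
    (w := fun n => (Rabs (Re (a n)) + Rabs (Im (a n)))%R).
  - intros n; split; [apply Cmod_ge_0|].
    (* The triangle inequality for [z = Re z + Ci * Im z] bounds [Cmod z] by the sum of the absolute
       values of its components. *)
    rewrite <- (Cmod_R (Re (a n))), <- (Cmod_R (Im (a n))).
    replace (Cmod (RtoC (Im (a n)))) with (Cmod (Ci * Im (a n))).
    + eapply Rle_trans; [|apply Cmod_triangle]; apply Req_le; f_equal.
      destruct (a n) as [u v]; unfold Re, Im, Ci, RtoC, Cplus, Cmult; simpl.
      f_equal; ring.
    + rewrite Cmod_mult.
      replace (Cmod Ci) with 1%R; [ring|].
      unfold Cmod, Ci; simpl.
      replace (0 * (0 * 1) + 1 * (1 * 1))%R with 1%R by ring.
      now rewrite sqrt_1.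
  - apply is_lim_seq_const.
  - replace (Finite 0) with (Finite (0 + 0)) by (f_equal; ring).
    now apply is_lim_seq_plus'.
Qed.

(** * Splitting by parity and the formal identities *)

Lemma Csum_even_odd (f : nat -> C) (n : nat) :
  sum_n f (2 * n + 1) =
  sum_n (fun j => f (2 * j)%nat) n + sum_n (fun j => f (2 * j + 1)%nat) n :> C.
Proof.
  induction n as [|n IH].
  - change (2 * 0 + 1)%nat with 1%nat; now rewrite Csum_S, !Csum_O.
  - rewrite !(Csum_S _ n).
    replace (2 * S n + 1)%nat with (S (S (2 * n + 1))) by lia.
    rewrite !Csum_S, IH.
    replace (S (S (2 * n + 1)))%nat with (2 * S n + 1)%nat by lia.
    replace (S (2 * n + 1))%nat with (2 * S n)%nat by lia.
    ring.
Qed.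

Lemma one_minus_pow_neq_0 (q : C) (n : nat) :
  (Cmod q < 1)%R -> 1 - q ^ S n <> 0.
Proof.
  intros Hq E.
  assert (H : q ^ S n = 1) by (rewrite <- (Cplus_0_r (q ^ S n)), <- E; ring).
  apply (f_equal Cmod) in H; rewrite Cmod_pow, Cmod_1 in H; simpl in H.
  assert (H1 := Cmod_ge_0 q).
  assert (H2 : (Cmod q ^ n <= 1 ^ n)%R) by (apply pow_incr; lra).
  rewrite pow1 in H2; nra.
Qed.

Lemma one_minus_neq_0 (q : C) : (Cmod q < 1)%R -> 1 - q <> 0.
Proof.
  intros Hq; replace q with (q ^ 1) by (simpl; ring).
  now apply one_minus_pow_neq_0.
Qed.

Lemma qfact_neq_0 (q : C) (n : nat) : (Cmod q < 1)%R -> qfact q n <> 0.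
Proof.
  intros Hq; induction n as [|n IH]; cbn [qfact].
  - exact C1_nz.
  - apply Cmult_neq_0; [|exact IH].
    unfold qint, Cdiv; apply Cmult_neq_0.
    + now apply one_minus_pow_neq_0.
    + intros E; apply C1_nz; rewrite <- (Cinv_r (1 - q)), E;
        [ring | now apply one_minus_neq_0].
Qed.

(** The terms of the q-exponential series, of which the q-cosine and q-sine take the even and the
    odd ones, up to sign. *)
Definition qexp_term (q x : C) (n : nat) : C := x ^ n / qfact q n.

Lemma qadd_powers_qexp (q x y : C) (n : nat) : (Cmod q < 1)%R ->
  qadd_powers q x y n =
  qfact q n * cauchy_prod (qexp_term q x) (qexp_term q y) n.
Proof.
  intros Hq; unfold qadd_powers, cauchy_prod; rewrite <- Csum_mult_l.
  apply Csum_ext_loc; intros k _.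
  unfold qbinom, qexp_term; field.
  split; now apply qfact_neq_0.
Qed.

Lemma Cpow_m1_sub (k n : nat) :
  (k <= n)%nat -> (- (1)) ^ k * (- (1)) ^ (n - k) = (- (1) : C) ^ n.
Proof. intros H; rewrite <- Cpow_add_r; f_equal; lia. Qed.

(** In this lemma and the next three, the exponent of [y] is written as the total degree minus that
    of [x]: this is the form in which [Csum_even_odd] splits the convolution of two q-exponential
    series. *)
Lemma cauchy_prod_cos_sin (q x y : C) (n : nat) :
  cauchy_prod (cosq_term q (powers x)) (sinq_term q (powers y)) n =
  (- (1)) ^ n *
  sum_n (fun j => qexp_term q x (2 * j) * qexp_term q y (2 * n + 1 - 2 * j)) n.
Proof.
  unfold cauchy_prod; rewrite <- Csum_mult_l.
  apply Csum_ext_loc; intros k Hk; rewrite <- (Cpow_m1_sub k n Hk).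
  unfold cosq_term, sinq_term, powers, qexp_term, Cdiv.
  replace (2 * n + 1 - 2 * k)%nat with (2 * (n - k) + 1)%nat by lia; ring.
Qed.

Lemma cauchy_prod_sin_cos (q x y : C) (n : nat) :
  cauchy_prod (sinq_term q (powers x)) (cosq_term q (powers y)) n =
  (- (1)) ^ n *
  sum_n (fun j => qexp_term q x (2 * j + 1) *
                  qexp_term q y (2 * n + 1 - (2 * j + 1))) n.
Proof.
  unfold cauchy_prod; rewrite <- Csum_mult_l.
  apply Csum_ext_loc; intros k Hk; rewrite <- (Cpow_m1_sub k n Hk).
  unfold cosq_term, sinq_term, powers, qexp_term, Cdiv.
  replace (2 * n + 1 - (2 * k + 1))%nat with (2 * (n - k))%nat by lia; ring.
Qed.

Lemma cauchy_prod_cos_cos (q x y : C) (n : nat) :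
  cauchy_prod (cosq_term q (powers x)) (cosq_term q (powers y)) n =
  (- (1)) ^ n *
  sum_n (fun j => qexp_term q x (2 * j) * qexp_term q y (2 * n - 2 * j)) n.
Proof.
  unfold cauchy_prod; rewrite <- Csum_mult_l.
  apply Csum_ext_loc; intros k Hk; rewrite <- (Cpow_m1_sub k n Hk).
  unfold cosq_term, powers, qexp_term, Cdiv.
  replace (2 * n - 2 * k)%nat with (2 * (n - k))%nat by lia; ring.
Qed.

(** The total degree is [2 * S n] while the sign is still that of [n]; this mismatch is the source
    of the minus sign in the cosine formula. *)
Lemma cauchy_prod_sin_sin (q x y : C) (n : nat) :
  cauchy_prod (sinq_term q (powers x)) (sinq_term q (powers y)) n =
  (- (1)) ^ n *
  sum_n (fun j => qexp_term q x (2 * j + 1) *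
                  qexp_term q y (2 * S n - (2 * j + 1))) n.
Proof.
  unfold cauchy_prod; rewrite <- Csum_mult_l.
  apply Csum_ext_loc; intros k Hk; rewrite <- (Cpow_m1_sub k n Hk).
  unfold sinq_term, powers, qexp_term, Cdiv.
  replace (2 * S n - (2 * k + 1))%nat with (2 * (n - k) + 1)%nat by lia; ring.
Qed.

Lemma cosq_add_formal_holds (q x y : C) :
  (Cmod q < 1)%R -> cosq_add_formal q x y.
Proof.
  intros Hq n; unfold cosq_term at 1.
  rewrite qadd_powers_qexp by exact Hq.
  rewrite cauchy_prod_cos_cos; unfold cauchy_prod at 1.
  assert (Hf := qfact_neq_0 q (2 * n) Hq).
  destruct n as [|n]; unfold PS_incr_1.
  - simpl Nat.mul; rewrite !Csum_O; change (@zero _) with (RtoC 0).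
    simpl; field.
  - rewrite cauchy_prod_sin_sin, Csum_S.
    set (f := fun k => qexp_term q x k * qexp_term q y (2 * S n - k)).
    (* Up to [2 * S n] there is one more even index than odd ones, so the last term is split off
       before the parities are separated. *)
    replace (sum_n f (2 * S n)) with (sum_n f (2 * n + 1) + f (2 * S n)%nat).
    + rewrite Csum_even_odd; unfold f at 1 2; rewrite (Cpow_S _ n).
      change (f (2 * S n)%nat) with
        (qexp_term q x (2 * S n) * qexp_term q y (2 * S n - 2 * S n)).
      field; exact Hf.
    + replace (2 * S n)%nat with (S (2 * n + 1)) by lia.
      now rewrite Csum_S.
Qed.

Lemma sinq_add_formal_holds (q x y : C) :
  (Cmod q < 1)%R -> sinq_add_formal q x y.
Proof.
  intros Hq n; unfold sinq_term at 1.
  rewrite qadd_powers_qexp by exact Hq.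
  rewrite cauchy_prod_cos_sin, cauchy_prod_sin_cos; unfold cauchy_prod at 1.
  rewrite Csum_even_odd; field.
  now apply qfact_neq_0.
Qed.

(** * Growth of the terms and absolute convergence *)

(** The ratio of consecutive terms, cleared of its denominator. As [q ^ S n] tends to 0, the ratio
    tends to [x * (1 - q)]; both the lower and the upper bound on the terms start from here. *)
Lemma qexp_term_S (q x : C) (n : nat) : (Cmod q < 1)%R ->
  qexp_term q x (S n) * (1 - q ^ S n) = qexp_term q x n * (x * (1 - q)).
Proof.
  intros Hq; unfold qexp_term; cbn [qfact]; unfold qint; rewrite (Cpow_S x).
  field; repeat split.
  - now apply qfact_neq_0.
  - now apply one_minus_neq_0.
  - now apply one_minus_pow_neq_0.
Qed.

(* [|1 - q ^ k| <= exp (|q| ^ k)], so the product of these factors over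
   [k <= n] is at most [exp (sum_k |q| ^ k)]. *)
Lemma Cmod_qexp_term_ge (q x : C) (n : nat) :
  (Cmod q < 1)%R -> (1 <= Cmod (x * (1 - q)))%R ->
  (1 <= exp ((1 - Cmod q ^ S n) / (1 - Cmod q)) * Cmod (qexp_term q x n))%R.
Proof.
  intros Hq Hx; induction n as [|n IH].
  - replace (qexp_term q x 0) with (RtoC 1) by (unfold qexp_term; simpl; field).
    rewrite Cmod_1, Rmult_1_r.
    rewrite <- exp_0 at 1; apply Rlt_le, exp_increasing.
    apply Rdiv_lt_0_compat; simpl; lra.
  - assert (E := f_equal Cmod (qexp_term_S q x n Hq)).
    rewrite !(Cmod_mult (qexp_term _ _ _)) in E.
    set (e := exp ((1 - Cmod q ^ S n) / (1 - Cmod q))) in *.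
    replace ((1 - Cmod q ^ S (S n)) / (1 - Cmod q))%R
      with ((1 - Cmod q ^ S n) / (1 - Cmod q) + Cmod q ^ S n)%R
      by (simpl; field; lra).
    rewrite exp_plus; fold e.
    assert (B : (Cmod (1 - q ^ S n) <= exp (Cmod q ^ S n))%R).
    { apply Rle_trans with (2 := exp_ineq1_le _).
      assert (T := Cmod_triangle 1 (- q ^ S n)).
      now rewrite Cmod_opp, Cmod_1, Cmod_pow in T. }
    assert (H0 := Cmod_ge_0 (qexp_term q x n)).
    assert (H1 := Cmod_ge_0 (qexp_term q x (S n))).
    assert (He : (0 < e)%R) by apply exp_pos.
    apply Rle_trans with (1 := IH).
    rewrite Rmult_assoc; apply Rmult_le_compat_l; [lra|].
    apply Rle_trans with (Cmod (qexp_term q x n) * Cmod (x * (1 - q)))%R; [nra|].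
    rewrite <- E, Rmult_comm; now apply Rmult_le_compat_r.
Qed.

Lemma Cmod_signed_term (q x : C) (n m : nat) :
  Cmod ((- (1)) ^ n * powers x m / qfact q m) = Cmod (qexp_term q x m).
Proof.
  unfold qexp_term, powers, Cdiv.
  rewrite !Cmod_mult, Cmod_pow, Cmod_opp, Cmod_1, pow1; ring.
Qed.

Lemma cosq_convergence_radius (q x s : C) :
  (Cmod q < 1)%R -> is_cosq q (powers x) s -> (Cmod (x * (1 - q)) < 1)%R.
Proof.
  intros Hq Hs; apply Rnot_le_lt; intros Hx.
  assert (L := C_is_series_lim_0 _ _ Hs).
  (* The exponent is the full geometric sum, so [B] bounds the factor in [Cmod_qexp_term_ge] for all
     [n] at once. The terms then stay above [/ B], and the limit 0 would give [/ B <= 0]. *)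
  set (B := exp (/ (1 - Cmod q))).
  assert (HB : (0 < B)%R) by apply exp_pos.
  assert (C0 : Rbar_le (/ B)%R 0%R).
  { apply (is_lim_seq_le (fun _ => / B)%R _ _ _) with (3 := L);
      [intros n | apply is_lim_seq_const].
    unfold cosq_term; rewrite Cmod_signed_term.
    apply (Rmult_le_reg_l B); [exact HB|]; rewrite Rinv_r by lra.
    apply Rle_trans with (1 := Cmod_qexp_term_ge q x (2 * n) Hq Hx).
    apply Rmult_le_compat_r; [apply Cmod_ge_0|].
    apply Rnot_lt_le; intros F; apply exp_lt_inv in F; revert F.
    apply Rle_not_lt; unfold Rdiv; rewrite <- (Rmult_1_l (/ _)) at 2.
    apply Rmult_le_compat_r.
    - apply Rlt_le, Rinv_0_lt_compat; lra.
    - assert (H := pow_le (Cmod q) (S (2 * n)) (Cmod_ge_0 q)); lra. }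
  simpl in C0; assert (H := Rinv_0_lt_compat B HB); lra.
Qed.

(** The constant [M] absorbs the first [N] terms, one at a time: the induction on [N] passes to the
    shifted sequence. *)
Lemma geometric_bound (t : nat -> R) (rho : R) (N : nat) :
  (0 < rho)%R -> (forall n, (N <= n)%nat -> t (S n) <= rho * t n)%R ->
  exists M, forall n, (t n <= M * rho ^ n)%R.
Proof.
  intros Hrho; revert t; induction N as [|N IH]; intros t Ht.
  - exists (t 0%nat); induction n as [|n IHn].
    + simpl; lra.
    + apply Rle_trans with (1 := Ht n (Nat.le_0_l n)); simpl; nra.
  - destruct (IH (fun n => t (S n))) as [M HM].
    { intros n Hn; apply Ht; lia. }
    exists (Rmax (t 0%nat) (M / rho)); intros [|n].
    + simpl; rewrite Rmult_1_r; apply Rmax_l.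
    + apply Rle_trans with (1 := HM n).
      apply Rle_trans with (M / rho * rho ^ S n)%R.
      * apply Req_le; simpl; field; lra.
      * apply Rmult_le_compat_r; [apply pow_le; lra | apply Rmax_r].
Qed.

Lemma Cmod_qexp_term_le (q x : C) :
  (Cmod q < 1)%R -> (Cmod (x * (1 - q)) < 1)%R ->
  exists M rho, (0 < rho < 1)%R /\
    forall n, (Cmod (qexp_term q x n) <= M * rho ^ n)%R.
Proof.
  intros Hq Hx; set (d := Cmod (x * (1 - q))) in *.
  assert (Hd : (0 <= d)%R) by apply Cmod_ge_0.
  (* Any number strictly between the limit ratio [d] and 1 would do; the midpoint is also positive
     when [d] is 0. *)
  set (rho := ((1 + d) / 2)%R).
  assert (Hrho : (0 < rho < 1 /\ d < rho)%R) by (unfold rho; lra).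
  destruct Hrho as [Hrho Hdr].
  assert (Hq0 := Cmod_ge_0 q).
  (* The threshold is chosen so that [Cmod q ^ S n < (rho - d) / rho] means
     [d < rho * (1 - Cmod q ^ S n)], which makes the ratio at most [rho]. *)
  destruct (pow_lt_1_zero (Cmod q)) with (y := ((rho - d) / rho)%R) as [N HN].
  { rewrite Rabs_right; lra. }
  { apply Rdiv_lt_0_compat; lra. }
  destruct (geometric_bound (fun n => Cmod (qexp_term q x n)) rho N) as [M HM].
  - lra.
  - intros n Hn; cbv beta.
    assert (E := f_equal Cmod (qexp_term_S q x n Hq)).
    rewrite !(Cmod_mult (qexp_term _ _ _)) in E; fold d in E.
    assert (P := HN (S n) (le_S _ _ Hn)).
    rewrite Rabs_right in P by (apply Rle_ge, pow_le, Cmod_ge_0).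
    assert (T : (1 - Cmod q ^ S n <= Cmod (1 - q ^ S n))%R).
    { assert (T := Cmod_triangle (1 - q ^ S n) (q ^ S n)).
      replace (1 - q ^ S n + q ^ S n) with (RtoC 1) in T by ring.
      rewrite Cmod_1, Cmod_pow in T; lra. }
    assert (G : (d <= rho * Cmod (1 - q ^ S n))%R).
    { apply (Rmult_lt_compat_l rho) in P; [|lra].
      replace (rho * ((rho - d) / rho))%R with (rho - d)%R in P by (field; lra).
      nra. }
    assert (H0 := Cmod_ge_0 (qexp_term q x n)).
    assert (H1 := Cmod_ge_0 (qexp_term q x (S n))).
    assert (Hc : (0 < Cmod (1 - q ^ S n))%R)
      by now apply Cmod_gt_0, one_minus_pow_neq_0.
    apply (Rmult_le_reg_r (Cmod (1 - q ^ S n))); [exact Hc|].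
    rewrite E; nra.
  - exists M, rho; split; [exact Hrho | exact HM].
Qed.

Lemma ex_series_Cmod_geometric (a : nat -> C) (M rho : R) :
  (0 < rho < 1)%R -> (forall n, Cmod (a n) <= M * rho ^ n)%R ->
  ex_series (fun n => Cmod (a n)).
Proof.
  intros Hrho H.
  apply (ex_series_le (K := R_AbsRing) (V := R_CompleteNormedModule))
    with (b := fun n => (M * rho ^ n)%R).
  - intros n; unfold norm; simpl; unfold abs; simpl.
    rewrite Rabs_right; [apply H | apply Rle_ge, Cmod_ge_0].
  - apply (ex_series_scal_l (K := R_AbsRing) (V := R_NormedModule) M).
    apply ex_series_geom; rewrite Rabs_right; lra.
Qed.

Lemma cosq_sinq_abs_convergence (q x : C) :
  (Cmod q < 1)%R -> (Cmod (x * (1 - q)) < 1)%R ->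
  ex_series (fun n => Cmod (cosq_term q (powers x) n)) /\
  ex_series (fun n => Cmod (sinq_term q (powers x) n)).
Proof.
  intros Hq Hx; destruct (Cmod_qexp_term_le q x Hq Hx) as [M [rho [Hrho H]]].
  (* Each series takes every second term, hence the ratio [rho ^ 2]; the odd indices of the sine put
     one further factor [rho] into the constant. *)
  assert (Hrho2 : (0 < rho ^ 2 < 1)%R) by (simpl; nra).
  split.
  - apply ex_series_Cmod_geometric with M (rho ^ 2)%R; [exact Hrho2|].
    intros n; unfold cosq_term; rewrite Cmod_signed_term, <- pow_mult; apply H.
  - apply ex_series_Cmod_geometric with (M * rho)%R (rho ^ 2)%R; [exact Hrho2|].
    intros n; unfold sinq_term; rewrite Cmod_signed_term, <- pow_mult.
    apply Rle_trans with (1 := H _), Req_le; rewrite pow_add; simpl; ring.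
Qed.

(** * From the formal identities to the sums *)

Theorem theorem5 :
  forall (x y : R) (q : C), (Cmod q < 1)%R ->
    (cosq_add_formal q (RtoC x) (RtoC y) /\ sinq_add_formal q (RtoC x) (RtoC y))
    /\
    (forall cx sx cy sy : C,
       is_cosq q (powers (RtoC x)) cx -> is_sinq q (powers (RtoC x)) sx ->
       is_cosq q (powers (RtoC y)) cy -> is_sinq q (powers (RtoC y)) sy ->
       is_cosq q (qadd_powers q (RtoC x) (RtoC y)) (cx * cy - sx * sy)%C /\
       is_sinq q (qadd_powers q (RtoC x) (RtoC y)) (sx * cy + cx * sy)%C).
Proof.
  intros x y q Hq.
  assert (Fc := cosq_add_formal_holds q x y Hq).
  assert (Fs := sinq_add_formal_holds q x y Hq).
  split; [now split|].
  intros cx sx cy sy Hcx Hsx Hcy Hsy.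
  destruct (cosq_sinq_abs_convergence q x Hq (cosq_convergence_radius q x cx Hq Hcx))
    as [Acx Asx].
  destruct (cosq_sinq_abs_convergence q y Hq (cosq_convergence_radius q y cy Hq Hcy))
    as [Acy Asy].
  split.
  - eapply is_series_ext; [intros n; symmetry; apply Fc|].
    apply (is_series_minus (K := C_AbsRing) (V := C_NormedModule)).
    + now apply C_is_series_cauchy_prod.
    (* Dropping the prepended zero undoes the shift; the sum changes only by that zero, which is the
       [- 0] below. *)
    + apply is_series_decr_1.
      change (C_is_series (cauchy_prod (sinq_term q (powers x))
        (sinq_term q (powers y))) (sx * sy + - 0)).
      replace (sx * sy + - 0) with (sx * sy) by ring.
      now apply C_is_series_cauchy_prod.
  - eapply is_series_ext; [intros n; symmetry; apply Fs|].
    apply (is_series_plus (K := C_AbsRing) (V := C_NormedModule));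
      now apply C_is_series_cauchy_prod.
Qed.
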